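(* For $n\ge 0$, $(D^n)^G \cong k$ (that is, it is one-dimensional) if $n$ is even, and $(D^n)^G=0$ if $n$ is odd.
   Context: $k$ is a field of characteristic $p>2$; $\mathfrak g=\mathfrak{sl}_2(k)$; $G=\mathsf{SL}_2$ as an algebraic group over $k$. For a $k$-vector space $V$ with basis $v_1,\dots,v_d$, the divided power algebra $D(V)$ is the commutative algebra with basis $v_1^{(a_1)}\cdots v_d^{(a_d)}$ ($a_i\ge0$) and multiplication determined by $v^{(a)}v^{(b)}=\binom{a+b}{a}v^{(a+b)}$; it is graded with $v_1^{(a_1)}\cdots v_d^{(a_d)}$ in degree $\sum a_i$. It is identified with the graded dual $\bigoplus_n S^n(V^* )^*$ of the symmetric algebra $S(V^* )$, where $S(V^* )$ has the coalgebra structure with $v\mapsto v\otimes1+1\otimes v$ for $v\in V^*$; via this identification a $G$-action on $V$ gives a $G$-action on $D(V)$ by graded algebra automorphisms. $D^n=D^n(\mathfrak g)$ is the degree $n$ part of $D(\mathfrak g)$, where $G$ acts on $\mathfrak g$ by the adjoint action. *)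

(* Defs.v *)
From HB Require Import structures.
From mathcomp Require Import all_boot all_algebra.
From mathcomp Require Import boolp.
From mathcomp Require Import ssrcomplements mpoly.

Set Implicit Arguments.
Unset Strict Implicit.
Unset Printing Implicit Defensive.

Import GRing.Theory.
Local Open Scope ring_scope.

(* The divided power algebra D(V) of a free A-module V with basis             *)
(* v_1, ..., v_d. As an A-module it is the free module on the multi-indices   *)
(* 'X_{1..d}, so it reuses the carrier of {mpoly A[d]}: there 'X_[a] stands   *)
(* for v_1^(a_1) ... v_d^(a_d), u@_a is the coefficient of u on it, and       *)
(* n.-homog is the degree n part. The ring structure is NOT the one of        *)
(* {mpoly A[d]}: see dp_mul.                                                  *)
Definition divpow (d : nat) (A : nzRingType) : Type := {mpoly A[d]}.

HB.instance Definition _ d (A : nzRingType) :=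
  GRing.Lmodule.copy (divpow d A) {mpoly A[d]}.

Definition dp_basis d (A : nzRingType) (a : 'X_{1..d}) : divpow d A := 'X_[a].

(* The A-linear map D(V) -> W with values F a on the basis. *)
Definition dp_ext d (A : nzRingType) (W : lmodType A) (F : 'X_{1..d} -> W)
    (u : divpow d A) : W :=
  \sum_(a <- msupp u) u@_a *: F a.

Definition mnm_bin d (a b : 'X_{1..d}) : nat := \prod_(i < d) 'C(a i + b i, a i).

(* v^(a) v^(b) = binom(a + b, a) v^(a + b), coordinatewise. *)
Definition dp_mul d (A : nzRingType) (u v : divpow d A) : divpow d A :=
  dp_ext (fun a =>
    dp_ext (fun b => (mnm_bin a b)%:R *: dp_basis A (a + b)%MM) v) u.

Section DividedPowers.
Variables (d : nat) (A : comNzRingType).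
Implicit Types (u v w : divpow d A) (a b c : 'X_{1..d}).

Section Ext.
Variable W : lmodType A.
Implicit Type F : 'X_{1..d} -> W.

Lemma dp_extwE F u k : (msize u <= k)%N ->
  dp_ext F u = \sum_(a : 'X_{1..d < k}) u@_a *: F a.
Proof.
move=> le_uk; rewrite /dp_ext (big_mksub 'X_{1..d < k}) /=.
- by rewrite big_rmcond //= => a /memN_msupp_eq0 ->; rewrite scale0r.
- exact: msupp_uniq.
- by move=> a /msize_mdeg_lt /leq_trans; apply.
Qed.

Lemma dp_ext_is_linear F : linear (dp_ext F).
Proof.
move=> x u v; pose k := maxn (msize u) (maxn (msize v) (msize (x *: u + v))).
rewrite !(@dp_extwE _ _ k) ?leq_max ?leqnn ?orbT //.
rewrite scaler_sumr -big_split; apply: eq_bigr => a _ /=.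
by rewrite [(_ + _)@_ _]linearP /= scalerDl scalerA.
Qed.

HB.instance Definition _ F :=
  GRing.isLinear.Build A (divpow d A) W *:%R (dp_ext F) (dp_ext_is_linear F).

Lemma dp_ext_basis F a : dp_ext F (dp_basis A a) = F a.
Proof. by rewrite /dp_ext msuppX big_seq1 mcoeffX eqxx scale1r. Qed.

Lemma eq_dp_ext F1 F2 u : F1 =1 F2 -> dp_ext F1 u = dp_ext F2 u.
Proof. by move=> eqF; apply: eq_bigr => a _; rewrite eqF. Qed.

Lemma dp_extS F x u : x *: dp_ext F u = dp_ext (fun a => x *: F a) u.
Proof.
by rewrite scaler_sumr; apply: eq_bigr => a _; rewrite !scalerA mulrC.
Qed.

Lemma dp_extD F1 F2 u :
  dp_ext F1 u + dp_ext F2 u = dp_ext (fun a => F1 a + F2 a) u.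
Proof. by rewrite -big_split; apply: eq_bigr => a _; rewrite /= scalerDr. Qed.

End Ext.

Lemma dp_expand u : u = dp_ext (@dp_basis d A) u.
Proof. exact: mpolyE. Qed.

Lemma dp_ext_comp (V W : lmodType A) (f : {linear V -> W}) F u :
  f (dp_ext F u) = dp_ext (fun a => f (F a)) u.
Proof. by rewrite linear_sum; apply: eq_bigr => a _; rewrite linearZ. Qed.

Lemma dp_ext_swap (W : lmodType A) (F : 'X_{1..d} -> 'X_{1..d} -> W) u v :
  dp_ext (fun a => dp_ext (F a) v) u =
  dp_ext (fun b => dp_ext (fun a => F a b) u) v.
Proof.
rewrite /dp_ext; under eq_bigr do rewrite scaler_sumr.
rewrite exchange_big; apply: eq_bigr => b _ /=.
by rewrite scaler_sumr; apply: eq_bigr => a _; rewrite !scalerA mulrC.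
Qed.

Lemma mnm_binC a b : mnm_bin a b = mnm_bin b a.
Proof.
apply: eq_bigr => i _.
by rewrite -[in LHS]bin_sub ?leq_addr // addKn addnC.
Qed.

Lemma mnm_binA a b c :
  (mnm_bin b c * mnm_bin a (b + c) = mnm_bin a b * mnm_bin (a + b) c)%N.
Proof.
rewrite /mnm_bin -!big_split; apply: eq_bigr => i _ /=; rewrite !mnmDE.
move: (a i) (b i) (c i) => x y z.
apply/eqP; rewrite -(@eqn_pmul2r (x`! * y`! * z`!)) ?muln_gt0 ?fact_gt0 //.
have E m n : ('C(m + n, m) * (m`! * n`!) = (m + n)`!)%N.
  by rewrite -{2}(addKn m n) bin_fact ?leq_addr.
apply/eqP; transitivity ((x + y + z)`!)%N.
  by rewrite -(mulnA x`!) (mulnC 'C(_, y)) mulnACA E -mulnA E addnA.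
by rewrite mulnACA E mulnCA E.
Qed.

Lemma dp_mul_basis a b :
  dp_mul (dp_basis A a) (dp_basis A b) =
  (mnm_bin a b)%:R *: dp_basis A (a + b)%MM.
Proof. by rewrite /dp_mul !dp_ext_basis. Qed.

Lemma dp_mulC : commutative (@dp_mul d A).
Proof.
move=> u v; rewrite /dp_mul dp_ext_swap; apply: eq_dp_ext => b.
by apply: eq_dp_ext => a; rewrite mnm_binC addmC.
Qed.

Lemma dp_mulDl : left_distributive (@dp_mul d A) +%R.
Proof. by move=> u v w; rewrite /dp_mul linearD. Qed.

Lemma dp_mulZl x u v : x *: dp_mul u v = dp_mul (x *: u) v.
Proof. by rewrite /dp_mul linearZ. Qed.

Lemma dp_mul_extl F u v :
  dp_mul (dp_ext F u) v = dp_ext (fun a => dp_mul (F a) v) u.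
Proof.
exact: (dp_ext_comp (dp_ext (W := divpow d A) _)).
Qed.

Lemma dp_mul_extr F u v :
  dp_mul v (dp_ext F u) = dp_ext (fun a => dp_mul v (F a)) u.
Proof.
by rewrite dp_mulC dp_mul_extl; apply: eq_dp_ext => a; rewrite dp_mulC.
Qed.

Lemma dp_mulA : associative (@dp_mul d A).
Proof.
move=> u v w; rewrite [u]dp_expand [v]dp_expand [w]dp_expand.
rewrite !dp_mul_extl; apply: eq_dp_ext => a.
rewrite dp_mul_extr [X in dp_mul X _]dp_mul_extr dp_mul_extl.
apply: eq_dp_ext => b.
rewrite !dp_mul_extr; apply: eq_dp_ext => c.
rewrite !dp_mul_basis -dp_mulZl [dp_mul _ (_ *: _)]dp_mulC -dp_mulZl.
rewrite [dp_mul _ (dp_basis A a)]dp_mulC !dp_mul_basis !scalerA -!natrM.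
by rewrite addmA mnm_binA.
Qed.

Lemma dp_mul1 : left_id (dp_basis A 0%MM) (@dp_mul d A).
Proof.
move=> u; rewrite /dp_mul dp_ext_basis {2}[u]dp_expand.
apply: eq_dp_ext => b; rewrite add0m /mnm_bin big1 ?scale1r // => i _.
by rewrite mnm0E bin0.
Qed.

Lemma dp_1_neq0 : dp_basis A (0%MM : 'X_{1..d}) != 0.
Proof.
apply/eqP => /(congr1 (mcoeff 0%MM)).
by rewrite mcoeffX eqxx mcoeff0; apply/eqP/oner_neq0.
Qed.

HB.instance Definition _ := GRing.Zmodule_isComNzRing.Build (divpow d A)
  dp_mulA dp_mulC dp_mul1 dp_mulDl dp_1_neq0.
HB.instance Definition _ :=
  GRing.Lmodule_isLalgebra.Build A (divpow d A) dp_mulZl.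
HB.instance Definition _ :=
  GRing.Lalgebra_isComAlgebra.Build A (divpow d A).

(* S(V^* ) is {mpoly A[d]}, where 'X_i is the i-th vector of the dual basis.  *)
(* The pairing for which v^(a) and 'X_[a] are dual bases identifies D(V) with *)
(* the graded dual of S(V^* ).                                                *)
Definition dp_pair (u : divpow d A) (f : {mpoly A[d]}) : A :=
  dp_ext (fun a => f@_a : A^o) u.

(* The effect on S(V^* ) of composing polynomial functions on V with the      *)
(* endomorphism v_j |-> \sum_i M i j *: v_i of V.                             *)
Definition sym_pullback (M : 'M[A]_d) (f : {mpoly A[d]}) : {mpoly A[d]} :=
  f \mPo [tuple \sum_(j < d) M i j *: 'X_j | i < d].

(* The endomorphism of D(V) dual to sym_pullback M (see dp_pair_act), which   *)
(* is the one induced by M: if g in G acts on V by M, it acts on S(V^* ) by   *)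
(* f |-> f o g^-1, hence on the graded dual by u |-> <u, sym_pullback M _>.   *)
(* sym_pullback preserves degrees, so the sum is over all the v^(a) of degree *)
(* at most that of u.                                                         *)
Definition dp_act (M : 'M[A]_d) (u : divpow d A) : divpow d A :=
  \sum_(a : 'X_{1..d < msize u})
     dp_pair u (sym_pullback M 'X_[a]) *: dp_basis A a.

Lemma sym_pullback_is_linear M : linear (sym_pullback M).
Proof. by move=> x f g; rewrite /sym_pullback linearP. Qed.

HB.instance Definition _ M := GRing.isLinear.Build A {mpoly A[d]} {mpoly A[d]}
  *:%R (sym_pullback M) (sym_pullback_is_linear M).

Lemma sym_pullbackX_homog M a : sym_pullback M 'X_[a] \is (mdeg a).-homog.
Proof.
rewrite /sym_pullback comp_mpolyX mdegE.
elim/big_rec2: _ => [|i m p _ hp]; first exact: dhomog1.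
apply: dhomogM => //; rewrite -[X in X.-homog]mul1n; apply: dhomogMn.
rewrite tnth_mktuple; apply: rpred_sum => j _; apply: rpredZ.
by rewrite dhomogX /= mdeg1.
Qed.

Lemma dp_pair_sym_pullback_eq0 M u a :
  (msize u <= mdeg a)%N -> dp_pair u (sym_pullback M 'X_[a]) = 0.
Proof.
move=> le_ua; rewrite /dp_pair /dp_ext big_seq big1 // => b ub.
rewrite (dhomog_nemf_coeff (sym_pullbackX_homog M a)) ?scaler0 //=.
by rewrite neq_ltn (leq_trans (msize_mdeg_lt ub)).
Qed.

Lemma mcoeff_dp_act M u a :
  (dp_act M u : {mpoly A[d]})@_a = dp_pair u (sym_pullback M 'X_[a]).
Proof.
rewrite /dp_act [X in mcoeff _ X](_ : _ = \sum_(b : 'X_{1..d < msize u})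
  dp_pair u (sym_pullback M 'X_[b]) *: 'X_[b] :> {mpoly A[d]}) //.
rewrite linear_sum /=; have [lt_au | le_ua] := ltnP (mdeg a) (msize u).
  rewrite (bigD1 (BMultinom lt_au)) //= big1 => [|b neq_ba].
    by rewrite linearZ /= mcoeffX eqxx mulr1 addr0.
  by rewrite linearZ /= mcoeffX -[a in X in _ == X]/(bmnm (BMultinom lt_au)) (inj_eq val_inj)
             (negPf neq_ba) mulr0.
rewrite dp_pair_sym_pullback_eq0 // big1 // => b _.
rewrite linearZ /= mcoeffX; case: eqP => [eq_ba|]; last by rewrite mulr0.
by have := bmdeg b; rewrite eq_ba ltnNge le_ua.
Qed.

Lemma dp_pair_linearl (f : {mpoly A[d]}) : linear (dp_pair^~ f : _ -> A^o).
Proof. by move=> x u v; rewrite /dp_pair linearP. Qed.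

Lemma dp_act_is_linear M : linear (dp_act M).
Proof.
move=> x u v; apply/mpolyP => a.
rewrite mcoeff_dp_act [RHS]linearP /= !mcoeff_dp_act.
exact: dp_pair_linearl.
Qed.

HB.instance Definition _ M := GRing.isLinear.Build A (divpow d A) (divpow d A)
  *:%R (dp_act M) (dp_act_is_linear M).

Lemma dp_pair_linearr u : linear (dp_pair u : _ -> A^o).
Proof.
move=> x f g; rewrite /dp_pair dp_extS dp_extD.
by apply: eq_dp_ext => a; rewrite linearP.
Qed.

HB.instance Definition _ u := GRing.isLinear.Build A {mpoly A[d]} A^o
  *:%R (dp_pair u) (dp_pair_linearr u).

Lemma dp_pairX u a : dp_pair u 'X_[a] = u@_a.
Proof.
rewrite [in RHS](mpolyE u) linear_sum; apply: eq_bigr => b _.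
by rewrite linearZ /= !mcoeffX eq_sym.
Qed.

Lemma dp_pair_act M u f : dp_pair (dp_act M u) f = dp_pair u (sym_pullback M f).
Proof.
rewrite [f]mpolyE (linear_sum (sym_pullback M)) !(linear_sum (dp_pair _)).
apply: eq_bigr => a _.
by rewrite !linearZ /= dp_pairX
  mcoeff_dp_act.
Qed.

Lemma dp_act_deg1 M j :
  dp_act M (dp_basis A U_(j)) = \sum_(i < d) M i j *: dp_basis A U_(i).
Proof.
apply/mpolyP => a; rewrite mcoeff_dp_act /dp_pair dp_ext_basis.
rewrite [X in _ = mcoeff a X](_ : _ =
  \sum_(i < d) M i j *: 'X_i :> {mpoly A[d]}) //.
have E i : (\sum_(l < d) M i l *: 'X_l : {mpoly A[d]})@_U_(j) = M i j.
  rewrite linear_sum (bigD1 j) //= big1 => [|l neq_lj].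
    by rewrite linearZ /= mcoeffX eqxx mulr1 addr0.
  by rewrite linearZ /= mcoeffX eq_mnm1 (negPf neq_lj) mulr0.
have [[i /eqP->] | neq_a1] := mdeg1P a.
  rewrite /sym_pullback comp_mpolyXU -tnth_nth tnth_mktuple E.
  rewrite linear_sum (bigD1 i) //= big1 => [|l neq_li].
    by rewrite linearZ /= mcoeffX eqxx mulr1 addr0.
  by rewrite linearZ /= mcoeffX eq_mnm1 (negPf neq_li) mulr0.
rewrite (dhomog_nemf_coeff (sym_pullbackX_homog M a)) /= ?mdeg1.
  rewrite linear_sum big1 // => i _; rewrite linearZ /= mcoeffX.
  by case: eqP => [ai|]; rewrite ?mulr0 //; case: neq_a1; exists i; rewrite ai.
by apply/negP => a1; apply/neq_a1/mdeg1P; rewrite eq_sym.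
Qed.

Lemma dp_act_homog M n u : (u : {mpoly A[d]}) \is n.-homog ->
  (dp_act M u : {mpoly A[d]}) \is n.-homog.
Proof.
move=> hu; apply/dhomogP => a; rewrite mcoeff_msupp mcoeff_dp_act.
apply: contraNeq => neq_an; rewrite /dp_pair /dp_ext big_seq big1 // => b ub.
rewrite (dhomog_nemf_coeff (sym_pullbackX_homog M a)) ?scaler0 //=.
by rewrite (dhomog_mf hu ub) eq_sym.
Qed.

End DividedPowers.

(* The basis e, h, f of sl_2(A) and its coordinate functions.                 *)
Definition sl2_basis (A : comNzRingType) (i : 'I_3) : 'M[A]_2 :=
  [:: delta_mx 0 1; delta_mx 0 0 - delta_mx 1 1; delta_mx 1 0]`_i.

Definition sl2_coord (A : comNzRingType) (X : 'M[A]_2) (i : 'I_3) : A :=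
  [:: X 0 1; X 0 0; X 1 0]`_i.

(* The matrix in that basis of X |-> g X g^-1; \adj g is the inverse of g in  *)
(* SL_2(A).                                                                   *)
Definition sl2_Ad (A : comNzRingType) (g : 'M[A]_2) : 'M[A]_3 :=
  \matrix_(i, j) sl2_coord (g *m sl2_basis A j *m \adj g) i.

Lemma sl2_coordK (A : comNzRingType) (X : 'M[A]_2) :
  \tr X = 0 -> X = \sum_(i < 3) sl2_coord X i *: sl2_basis A i.
Proof.
have ord2 (i : 'I_2) : i = 0 \/ i = 1.
  by case: i => [[|[|//]] ?]; [left | right]; apply: val_inj.
rewrite /mxtrace big_ord_recl big_ord1 (_ : lift _ _ = 1 :> 'I_2); last exact: val_inj.
move/eqP; rewrite addrC addr_eq0 => /eqP X11.
rewrite !big_ord_recl big_ord0 /sl2_coord /sl2_basis /=.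
apply/matrixP => i j; rewrite !mxE.
by case: (ord2 i) => ->; case: (ord2 j) => ->;
  rewrite /= ?X11 ?(mulr1, mulr0, mulrN, addr0, add0r, subr0, sub0r, oppr0).
Qed.

Lemma sl2_AdE (A : comNzRingType) (g : 'M[A]_2) (j : 'I_3) : \det g = 1 ->
  g *m sl2_basis A j *m \adj g = \sum_(i < 3) sl2_Ad g i j *: sl2_basis A i.
Proof.
move=> det1; rewrite [LHS]sl2_coordK.
  by apply: eq_bigr => i _; rewrite mxE.
rewrite mxtrace_mulC mulmxA mul_adj_mx det1 mul1mx /sl2_basis.
rewrite /mxtrace big_ord_recl big_ord1.
by case: j => [[|[|[|//]]] ?]; rewrite /= !mxE /= ?subr0 ?sub0r ?subrr ?addr0.
Qed.

(* The base change D(V) -> D(V) \otimes_k A = D(V \otimes_k A).               *)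
Definition dp_base_change d (k : nzRingType) (A : lalgType k)
    (u : divpow d k) : divpow d A :=
  map_mpoly (in_alg A) u.

(* (D^n)^G for the algebraic group G = SL_2 over k: the u in D^n(sl_2) whose  *)
(* image in D^n(sl_2) \otimes_k A is fixed by G(A), for all commutative       *)
(* k-algebras A. (G(k) alone would not do when k is finite.)                  *)
Definition is_dpinv (k : fieldType) (n : nat) : {pred divpow 3 k} :=
  fun u => ((u : {mpoly k[3]}) \is n.-homog) &&
    `[< forall (A : comAlgType k) (g : 'M[A]_2), \det g = 1 ->
          dp_act (sl2_Ad g) (dp_base_change A u) = dp_base_change A u >].

Lemma dp_base_changeP d (k : comNzRingType) (A : comAlgType k) x
    (u v : divpow d k) :
  dp_base_change A (x *: u + v) =
  x%:A *: dp_base_change A u + dp_base_change A v.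
Proof.
apply/mpolyP => a; rewrite [RHS]linearP /= !mcoeff_map_mpoly /=.
by rewrite [(_ + _)@_ _]linearP /= scalerDl -scalerA mulr_algl.
Qed.

Lemma is_dpinv_submod_closed (k : fieldType) n : submod_closed (@is_dpinv k n).
Proof.
split=> [|x u v /andP[hu /asboolP iu] /andP[hv /asboolP iv]]; apply/andP; split.
- exact: dhomog0.
- apply/asboolP => A g _; rewrite /dp_base_change raddf0.
  exact: (linear0 (dp_act (sl2_Ad g))).
- exact: (rpredD (rpredZ x hu) hv).
- apply/asboolP => A g det1; rewrite dp_base_changeP.
  by rewrite (linearP (dp_act (sl2_Ad g))) /= iu ?iv.
Qed.

HB.instance Definition _ (k : fieldType) n :=
  GRing.isSubmodClosed.Build k (divpow 3 k)
  (@is_dpinv k n) (@is_dpinv_submod_closed k n).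

Record dpinv (k : fieldType) (n : nat) : Type :=
  DPInv { dpinv_val :> divpow 3 k; dpinvP : is_dpinv n dpinv_val }.

HB.instance Definition _ (k : fieldType) n := [isSub for @dpinv_val k n].
HB.instance Definition _ (k : fieldType) n := [Choice of dpinv k n by <:].
HB.instance Definition _ (k : fieldType) n :=
  [SubChoice_isSubLmodule of dpinv k n by <:].

(* Main.v *)
Require Import Defs.
From HB Require Import structures.
From mathcomp Require Import all_boot all_algebra qpoly.
From mathcomp Require Import boolp mpoly ring zify.

(** Write x, y, z for the coordinates dual to the basis e, h, f of sl_2, so that
S = k[x, y, z] is the symmetric algebra of the dual. An invariant of D^n is a
functional phi on S^n with phi(s o Ad g) = phi(s) for all g in SL_2(A) and all
k-algebras A.

Invariance under the diagonal torus makes phi vanish on every monomial outside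
the x^c y^(n-2c) z^c ([dpinv_weight]). The Weyl element multiplies these by
(-1)^n, so for odd n nothing is left ([dpinv_odd]).

Let n = 2m and psi(c) = phi(x^c y^(n-2c) z^c). Under the upper unipotent with
parameter s, x, y, z become x - 2sy - s^2 z, y + sz, z. The coefficient of s in
the invariance of phi reads
  (2(m-c) - 1) psi(c+1) = 2(c+1) psi(c)        ([upinv_rec]).
In characteristic 0 this determines psi up to a scalar. In characteristic p the
recurrence breaks where a factor is divisible by p. If 2m < p-1 this never
happens. Otherwise write 2m = 2p m' + (p-1) + 2e with 0 <= e < p. Then psi
vanishes on the residues smaller than e modulo p ([rec_vanish]), and on each
block [jp + e, jp + p - 1] it is determined by psi(jp + e) ([rec_block]). So
phi is determined by the functional
  s |-> phi(s(x^p, y^p, z^p) x^e y^(p-1) z^e)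
on S^(2m'). This functional satisfies the same conditions ([upinv_frob]):
s(x^p, y^p, z^p) transforms by the Frobenius twist, and the other factor is fixed
modulo monomials whose products with s(x^p, y^p, z^p) are killed by phi.
Induction on m yields one monomial whose value determines phi ([upinv_unique]),
so (D^n)^G has dimension at most 1.

Conversely, the Laplacian Delta = 4 d_x d_z + d_y^2, dual to the invariant form
y^2 + x z, satisfies Delta(s o Ad g) = det(g)^2 (Delta s) o Ad g, where
Ad g X = g X adj(g) for an arbitrary 2 x 2 matrix g ([lap_sym_pullback]). So Delta^m is an invariant
functional on S^(2m). It is defined over the integers, where it is nonzero, but
it may vanish modulo p. Dividing it by the right power of p repairs this
([divpow_primitive]). The quotient is still invariant: invariance is a polynomial
identity in the entries of g, and may be checked for the generic matrix over
Z[a, b, c, d], which is a domain of characteristic 0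
([dp_act_divided_casimir]). *)

Set Implicit Arguments.
Unset Strict Implicit.
Unset Printing Implicit Defensive.

Import GRing.Theory.
Local Open Scope ring_scope.

(** * Coordinates and the adjoint action *)

(** The positions of e, h and f in the basis of sl_2. *)
Definition i0 : 'I_3 := @Ordinal 3 0 isT.
Definition i1 : 'I_3 := @Ordinal 3 1 isT.
Definition i2 : 'I_3 := @Ordinal 3 2 isT.

Lemma ord3P (i : 'I_3) : [\/ i = i0, i = i1 | i = i2].
Proof.
case: i => [[|[|[|//]]] ?]; [constructor 1|constructor 2|constructor 3];
exact: val_inj.
Qed.

Lemma big_ord3 (R : Type) (idx : R) (op : Monoid.law idx) (F : 'I_3 -> R) :
  \big[op/idx]_(i < 3) F i = op (op (F i0) (F i1)) (F i2).
Proof.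
rewrite !big_ord_recl big_ord0 Monoid.mulm1 Monoid.mulmA.
by congr (op (op (F _) (F _)) (F _)); apply: val_inj.
Qed.

Lemma sum3 (V : nmodType) (F : 'I_3 -> V) : \sum_(i < 3) F i = F i0 + F i1 + F i2.
Proof. exact: big_ord3. Qed.

Lemma mderivXU d (R : comNzRingType) (i j : 'I_d) :
  ('X_i : {mpoly R[d]})^`M(j) = (i == j)%:R.
Proof.
rewrite mderivX mnm1E; case: eqP => [->|_]; last by rewrite scale0r.
rewrite scale1r (_ : (_ - _)%MM = 0%MM) ?mpolyX0 //.
by apply/mnmP => l; rewrite mnmBE subnn mnm0E.
Qed.

Lemma mpolyX_ind d (R : comNzRingType) (P : {mpoly R[d]} -> Prop) :
  P 1 -> (forall f g, P f -> P g -> P (f * g)) -> (forall i, P 'X_i) ->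
  forall a, P 'X_[a].
Proof.
move=> P1 PM PX a; rewrite mpolyXE_id; apply: (big_ind P) => // i _.
by elim: (a i) => [|n IHn]; [rewrite expr0 | rewrite exprS; exact: (PM)].
Qed.

Definition mnm3 (a b c : nat) : 'X_{1..3} :=
  [multinom nth 0%N [:: a; b; c] i | i < 3].

Lemma mnm3E (a : 'X_{1..3}) : a = mnm3 (a i0) (a i1) (a i2).
Proof. by apply/mnmP => i; rewrite mnmE; case: (ord3P i) => ->. Qed.

Lemma mdeg3 (a : 'X_{1..3}) : mdeg a = (a i0 + a i1 + a i2)%N.
Proof. by rewrite mdegE big_ord3. Qed.

Lemma mpolyX3 (R : comNzRingType) (a : 'X_{1..3}) :
  'X_[a] = 'X_i0 ^+ a i0 * 'X_i1 ^+ a i1 * 'X_i2 ^+ a i2 :> {mpoly R[3]}.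
Proof. by rewrite mpolyXE_id big_ord3. Qed.

Lemma sym_pullback_monoid d (A : comNzRingType) (M : 'M[A]_d) :
  monoid_morphism (sym_pullback M).
Proof. by split; [exact: rmorph1|exact: rmorphM]. Qed.

HB.instance Definition _ d (A : comNzRingType) (M : 'M[A]_d) :=
  GRing.isMonoidMorphism.Build {mpoly A[d]} {mpoly A[d]} (sym_pullback M)
    (sym_pullback_monoid M).

Lemma sym_pullbackXU d (A : comNzRingType) (M : 'M[A]_d) i :
  sym_pullback M 'X_i = \sum_(j < d) M i j *: 'X_j.
Proof. by rewrite /sym_pullback comp_mpolyXU -tnth_nth tnth_mktuple. Qed.

Section Adjoint.
Variables (A : comNzRingType) (g : 'M[A]_2).

Lemma cofactor2 : [/\ cofactor g 0 0 = g 1 1, cofactor g 0 1 = - g 1 0,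
  cofactor g 1 0 = - g 0 1 & cofactor g 1 1 = g 0 0].
Proof.
have l00 : lift 0 0 = 1 :> 'I_2 by apply: val_inj.
have l10 : lift 1 0 = 0 :> 'I_2 by apply: val_inj.
split; rewrite /cofactor det_mx11 !mxE ?l00 ?l10 /= ?expr0 ?mul1r //.
- by rewrite expr1 mulN1r.
- by rewrite expr1 mulN1r.
by rewrite -signr_odd /= mul1r.
Qed.

(** The adjugate makes the entries of [sl2_Ad g] polynomials in those of g, for g
    of any determinant. *)
Lemma sl2_AdP (i j : 'I_3) : sl2_Ad g i j = (nth [::]
  [:: [:: g 0 0 ^+ 2; - (2 * g 0 0 * g 0 1); - g 0 1 ^+ 2];
      [:: - (g 0 0 * g 1 0); g 0 0 * g 1 1 + g 0 1 * g 1 0; g 0 1 * g 1 1];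
      [:: - g 1 0 ^+ 2; 2 * g 1 0 * g 1 1; g 1 1 ^+ 2]] i)`_j.
Proof.
case: cofactor2 => a00 a01 a10 a11.
have S2 F : \sum_(i < 2) F i = F 0 + F 1 :> A.
  by rewrite !big_ord_recl big_ord0 addr0; congr (_ + F _); apply: val_inj.
rewrite mxE /sl2_coord /sl2_basis.
by case: (ord3P i) => ->; case: (ord3P j) => -> /=;
  rewrite !mxE !S2 !mxE !S2 !mxE ?a00 ?a01 ?a10 ?a11 /=; ring.
Qed.

Lemma sl2_pullbackE (R := {mpoly A[3]}) (f := sym_pullback (sl2_Ad g)) :
  [/\ f 'X_i0 = g 0 0 ^+ 2 *: 'X_i0 - (2 * g 0 0 * g 0 1) *: 'X_i1
                - g 0 1 ^+ 2 *: 'X_i2 :> R,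
      f 'X_i1 = - (g 0 0 * g 1 0) *: 'X_i0
         + (g 0 0 * g 1 1 + g 0 1 * g 1 0) *: 'X_i1 + (g 0 1 * g 1 1) *: 'X_i2
    & f 'X_i2 = - g 1 0 ^+ 2 *: 'X_i0 + (2 * g 1 0 * g 1 1) *: 'X_i1
                + g 1 1 ^+ 2 *: 'X_i2].
Proof.
by rewrite /f !sym_pullbackXU !big_ord3 !sl2_AdP /= !scaleNr.
Qed.

Lemma det2 : \det g = g 0 0 * g 1 1 - g 0 1 * g 1 0.
Proof.
case: cofactor2 => c00 c01 _ _.
rewrite (expand_det_row g 0) !big_ord_recl big_ord0 addr0 c00.
by rewrite (_ : lift _ _ = 1) ?c01 ?mulrN //; apply: val_inj.
Qed.

End Adjoint.

Definition mx2 (A : nzRingType) (a b c d : A) : 'M[A]_2 :=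
  \matrix_(i, j) (nth [::] [:: [:: a; b]; [:: c; d]] i)`_j.

(** * Invariant functionals: weights and parity *)

(** A functional phi on the symmetric algebra is given by its values on monomials
    and extended A-linearly. No finiteness is asked of phi, so that functionals
    of all degrees are treated alike. *)
Definition extpair (d : nat) (k : comNzRingType) (A : comAlgType k)
    (phi : 'X_{1..d} -> k) (f : {mpoly A[d]}) : A^o :=
  dp_ext (fun a => (phi a)%:A : A^o) f.

Arguments extpair {d k} A phi f.

Section ExtPair.
Variables (d : nat) (k : comNzRingType) (A : comAlgType k).
Variable (phi : 'X_{1..d} -> k).

Lemma extpair_linear : linear (extpair A phi).
Proof. exact: dp_ext_is_linear. Qed.

HB.instance Definition _ :=
  GRing.isLinear.Build A {mpoly A[d]} A^o *:%R _ extpair_linear.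

Lemma extpairX a : extpair A phi 'X_[a] = (phi a)%:A.
Proof. exact: (dp_ext_basis (W := A^o)). Qed.

Lemma extpair_eq0 (f : {mpoly A[d]}) :
  {in msupp f, forall a, phi a = 0} -> extpair A phi f = 0.
Proof.
move=> phi0; rewrite /extpair /dp_ext big_seq big1 // => a fa.
by rewrite phi0 // scale0r scaler0.
Qed.

End ExtPair.

Lemma dpinv_extpair (k : fieldType) n (u : divpow 3 k) (A : comAlgType k)
    (g : 'M[A]_2) a :
  is_dpinv n u -> \det g = 1 ->
  extpair A (fun b => mcoeff b u) (sym_pullback (sl2_Ad g) 'X_[a])
    = (mcoeff a u)%:A.
Proof.
case/andP=> _ /asboolP inv /(inv A) /(congr1 (mcoeff a)).
rewrite mcoeff_dp_act mcoeff_map_mpoly /= => <-.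
rewrite [X in extpair _ _ X]mpolyE [X in dp_pair _ X]mpolyE.
rewrite (linear_sum (extpair A _)) (linear_sum (dp_pair _)).
apply: eq_bigr => b _; rewrite !linearZ /= extpairX dp_pairX.
by congr (_ * _); rewrite mcoeff_map_mpoly.
Qed.

Lemma dpinv_torus (k : fieldType) (A : comAlgType k) (t t' : A) n
    (u : divpow 3 k) a :
  is_dpinv n u -> t * t' = 1 ->
  mcoeff a u *: t ^+ (2 * a i0) = mcoeff a u *: t ^+ (2 * a i2).
Proof.
move=> inv tt'; pose g := mx2 t 0 0 t'.
have := dpinv_extpair a inv (_ : \det g = 1).
rewrite det2 !mxE /= mul0r subr0 tt' => /(_ erefl).
have [E0 E1 E2] := sl2_pullbackE g.
rewrite [X in sym_pullback _ X]mpolyX3 !rmorphM !rmorphXn /=.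
rewrite E0 E1 E2 !mxE /=.
rewrite !(mulr0, mul0r, expr0n, scale0r, oppr0, addr0, add0r, subr0) tt' scale1r.
rewrite !exprZn -!scalerAl -!scalerAr !scalerA linearZ /=.
rewrite -[X in extpair _ _ X](_ : 'X_[a] = _) ?extpairX; last first.
  exact: mpolyX3.
move=> /(congr1 (fun x => x * t ^+ (2 * a i2))).
rewrite -[_ *: (_ : A^o)]/(_ * _) -scalerAr mulr1 -!scalerAl mul1r => <-.
by rewrite -mulrA -!exprM -exprMn [t' * t]mulrC tt' expr1n mulr1.
Qed.

(** The torus needs a unit with distinct powers. The class of X in k[X]/(X^N - 1)
    is one as long as the exponents stay below N. *)
Lemma dpinv_weight (k : fieldType) n (u : divpow 3 k) a :
  is_dpinv n u -> mcoeff a u != 0 -> a i0 = a i2.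
Proof.
move=> inv ua.
pose N := (2 * (a i0 + a i2)).+2.
pose h : {poly k} := 'X^N - 1.
have mh : h \is monic by rewrite monicXnsubC.
have sh : size h = N.+1 by rewrite size_XnsubC.
have hm : mk_monic h = h by rewrite /mk_monic sh mh.
pose t : {poly %/ h} := in_qpoly h 'X.
have tN : t * t ^+ N.-1 = 1.
  rewrite -exprS; have h0 : in_qpoly h h = 0.
    apply: val_inj; change (Pdiv.CommonRing.rmodp h (mk_monic h) = 0).
    by rewrite hm Pdiv.RingMonic.rmodpp.
  by apply/eqP; rewrite -subr_eq0 -h0 rmorphB rmorphXn rmorph1.
have := dpinv_torus a inv tN.
move/(scalerI ua); rewrite -!rmorphXn /= => /(congr1 (@qpoly.polyn _ _)).
rewrite !in_qpoly_small ?hm ?sh ?size_polyXn; try lia.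
move=> /(congr1 (fun q : {poly k} => size q)).
by rewrite !size_polyXn; lia.
Qed.

(** The Weyl element exchanges x and z up to sign and negates y. On a monomial
    of weight 0 and degree n it is multiplication by (-1)^n. *)
Lemma dpinv_odd (k : fieldType) n (u : divpow 3 k) :
  (2%:R : k) != 0 -> odd n -> is_dpinv n u -> u = 0.
Proof.
move=> two odd_n inv; apply/mpolyP => a; rewrite mcoeff0.
apply/eqP/idPn => ua.
have aa := dpinv_weight inv ua.
have da : mdeg a = n.
  by case/andP: inv => hu _; apply: (dhomog_mf hu); rewrite mcoeff_msupp.
pose g : 'M[{poly k}]_2 := mx2 0 1 (-1) 0.
have := dpinv_extpair a inv (_ : \det g = 1).
rewrite det2 !mxE /= mul0r mul1r sub0r opprK => /(_ erefl).
have [E0 E1 E2] := sl2_pullbackE g.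
rewrite [X in sym_pullback _ X]mpolyX3 !rmorphM !rmorphXn /= E0 E1 E2 !mxE /=.
rewrite !(mulr0, mul0r, expr0n, scale0r, oppr0, addr0, add0r, subr0) /=.
rewrite sqrrN expr1n mul1r !scaleN1r !scale1r.
rewrite (exprNn 'X_i0) (exprNn 'X_i1) (exprNn 'X_i2).
rewrite [X in extpair _ _ X](_ : _ = (-1) ^+ mdeg a * 'X_[a]); last first.
  rewrite (mpolyX3 _ a) mdeg3 !exprD aa.
  set x := (-1) ^+ _; set y := (-1) ^+ _.
  move: ('X_i0 ^+ _) ('X_i1 ^+ _) ('X_i2 ^+ _) => X Y Z; ring.
rewrite da -signr_odd odd_n expr1 mulN1r linearN /= extpairX !alg_polyC.
move/(congr1 (coefp 0)); rewrite /= coefN !coefC /= => /eqP.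
rewrite eq_sym -subr_eq0 opprK -mulr2n -mulr_natl mulf_eq0 (negPf two).
by rewrite (negPf ua).
Qed.

(** * Invariance under the upper unipotent subgroup *)

Section Unipotent.
Variable k : fieldType.
Local Notation A := {poly k}.
Local Notation R := {mpoly A[3]}.

(** The upper unipotent subgroup, with the indeterminate of k[X] as parameter. *)
Definition upull : R -> R := sym_pullback (sl2_Ad (mx2 1 'X 0 1)).

HB.instance Definition _ := GRing.RMorphism.on upull.
HB.instance Definition _ := GRing.Linear.on upull.

Lemma upull0 : upull 'X_i0 = 'X_i0 - (2 * 'X) *: 'X_i1 - 'X ^+ 2 *: 'X_i2.
Proof.
rewrite /upull; have [-> _ _] := sl2_pullbackE (mx2 1 'X 0 1 : 'M[A]_2).
by rewrite !mxE /= expr1n scale1r mulr1.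
Qed.

Lemma upull1 : upull 'X_i1 = 'X_i1 + 'X *: 'X_i2.
Proof.
rewrite /upull; have [_ -> _] := sl2_pullbackE (mx2 1 'X 0 1 : 'M[A]_2).
by rewrite !mxE /= !(mulr0, oppr0, scale0r, add0r, addr0, mulr1, scale1r).
Qed.

Lemma upull2 : upull 'X_i2 = 'X_i2.
Proof.
rewrite /upull; have [_ _ ->] := sl2_pullbackE (mx2 1 'X 0 1 : 'M[A]_2).
by rewrite !mxE /= !(expr0n, mulr0, mul0r, oppr0, scale0r, add0r, expr1n, scale1r).
Qed.

(** The part of invariance that the uniqueness proof uses: weight 0, and
    invariance under the upper unipotent subgroup. This part is inherited by the
    functional of [upinv_frob]. *)
Definition upinv (n : nat) (phi : 'X_{1..3} -> k) :=
  (forall a, phi a != 0 -> mdeg a = n /\ a i0 = a i2) /\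
  (forall a, extpair A phi (upull 'X_[a]) = (phi a)%:A).

Lemma dpinv_upinv n u : is_dpinv n u -> upinv n (fun a => mcoeff a u).
Proof.
move=> inv; split=> a.
  move=> ua; split; last exact: dpinv_weight inv ua.
  by case/andP: inv => hu _; apply: (dhomog_mf hu); rewrite mcoeff_msupp.
by apply: dpinv_extpair inv _; rewrite det2 !mxE /= mulr0 subr0 mulr1.
Qed.

(** The derivation of S by which the Lie algebra of that subgroup acts. *)
Definition ulie (f : R) : R := - (2 * 'X_i1 * f^`M(i0)) + 'X_i2 * f^`M(i1).

Lemma upull_taylor a :
  exists r, upull 'X_[a] = 'X_[a] + 'X *: ulie 'X_[a] + 'X ^+ 2 *: r.
Proof.
pose P f := exists r, upull f = f + 'X *: ulie f + 'X ^+ 2 *: r.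
have PM f g : P f -> P g -> P (f * g).
  move=> [r Er] [s Es]; rewrite /P rmorphM /= Er Es /ulie !mderivM.
  set f0 := f^`M(i0); set f1 := f^`M(i1); set g0 := g^`M(i0); set g1 := g^`M(i1).
  exists (f * s + r * g + ('X *: r) * ('X *: s) +
    (- (2 * 'X_i1 * f0) + 'X_i2 * f1) * (- (2 * 'X_i1 * g0) + 'X_i2 * g1) +
    (- (2 * 'X_i1 * f0) + 'X_i2 * f1) * ('X *: s) +
    ('X *: r) * (- (2 * 'X_i1 * g0) + 'X_i2 * g1)).
  by rewrite -!mul_mpolyC rmorphXn; ring.
have P1 : P 1.
  exists 0; rewrite rmorph1 /ulie !mderivC.
  by rewrite !mulr0 oppr0 addr0 !scaler0 !addr0.
apply: (mpolyX_ind P1 PM) => i; case: (ord3P i) => ->.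
- exists (- 'X_i2); rewrite upull0 /ulie !mderivXU /=.
  by rewrite -!mul_mpolyC rmorphXn rmorphM rmorph_nat; ring.
- by exists 0; rewrite upull1 /ulie !mderivXU /= -!mul_mpolyC; ring.
by exists 0; rewrite upull2 /ulie !mderivXU /= -!mul_mpolyC; ring.
Qed.

Lemma ulieX a : ulie 'X_[a] =
  - (2 * a i0)%:R *: 'X_[U_(i1) + (a - U_(i0))]
  + (a i1)%:R *: 'X_[U_(i2) + (a - U_(i1))].
Proof.
rewrite /ulie !mderivX !mpolyXD -!mul_mpolyC.
by rewrite rmorphN !rmorph_nat natrM; ring.
Qed.

Lemma poly_taylor1_eq0 (c d1 d2 : k) (r : A) :
  c%:P + 'X * (d1%:P + d2%:P) + 'X ^+ 2 * r = c%:P -> d1 + d2 = 0.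
Proof.
move/(congr1 (coefp 1)); rewrite /= !coefD coefXM coefXnM coefD !coefC /=.
by rewrite add0r addr0.
Qed.

Lemma upinv_ulie n phi (a : 'X_{1..3}) : upinv n phi ->
  (a i1)%:R * phi (U_(i2) + (a - U_(i1)))%MM
    = (2 * a i0)%:R * phi (U_(i1) + (a - U_(i0)))%MM.
Proof.
case=> _ /(_ a); have [r ->] := upull_taylor a.
rewrite ulieX !(linearD, linearZ) /= !extpairX !alg_polyC => E.
apply/eqP; rewrite -subr_eq0 addrC -mulNr; apply/eqP.
apply: (@poly_taylor1_eq0 (phi a) _ _ (extpair A phi r)).
by rewrite !polyCM polyCN !polyC_natr; exact: E.
Qed.

(** The case of the monomial x^(c+1) y^(b+1) z^c, whose weight is -1. *)
Lemma upinv_rec n phi b c : upinv n phi ->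
  b.+1%:R * phi (mnm3 c.+1 b c.+1) = (2 * c.+1)%:R * phi (mnm3 c b.+2 c).
Proof.
move/(upinv_ulie (mnm3 c.+1 b.+1 c)); rewrite !mnmE /=.
rewrite (_ : (U_(i2) + _)%MM = mnm3 c.+1 b c.+1); last first.
  by apply/mnmP => i; rewrite !(mnmDE, mnmBE, mnmE); case: (ord3P i) => -> /=; lia.
rewrite (_ : (U_(i1) + _)%MM = mnm3 c b.+2 c) //.
by apply/mnmP => i; rewrite !(mnmDE, mnmBE, mnmE); case: (ord3P i) => -> /=; lia.
Qed.

(** Upper unipotents raise the weight: give x, y, z the weights -1, 0, 1. Then
    each of their images is the variable itself plus terms of larger weight, and
    this property is stable under products. *)
Lemma upull_tri a : {in msupp (upull 'X_[a] - 'X_[a]),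
  forall b : 'X_{1..3}, (b i0 + a i2 < a i0 + b i2)%N}.
Proof.
pose T (f : R) a := {in msupp (f - 'X_[a]),
  forall b : 'X_{1..3}, (b i0 + a i2 < a i0 + b i2)%N}.
have TM f g b c : T f b -> T g c -> T (f * g) (b + c)%MM.
  move=> Tf Tg d; rewrite mpolyXD.
  have -> : f * g - 'X_[b] * 'X_[c] = (f - 'X_[b]) * (g - 'X_[c])
      + ('X_[b] * (g - 'X_[c]) + (f - 'X_[b]) * 'X_[c]) by ring.
  move/msuppD_le; rewrite mem_cat => /orP[|/msuppD_le].
    case/msuppM_le/allpairsP => -[x y] /= [/Tf + /Tg + ->].
    by rewrite !mnmDE; lia.
  rewrite mem_cat => /orP[] /msuppM_le/allpairsP[[x y] /=] [].
    by move=> /mem_msuppXP <- /Tg + ->; rewrite !mnmDE; lia.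
  by move=> /Tf + /mem_msuppXP <- ->; rewrite !mnmDE; lia.
have TX f b n : T f b -> T (f ^+ n) (b *+ n)%MM.
  move=> Tf; elim: n => [|n IHn]; last by rewrite exprS mulmS; apply: (TM).
  by rewrite mulm0n expr0 /T mpolyX0 subrr msupp0.
suff: T (upull 'X_[a]) a by [].
have {2}-> : a = (U_(i0) *+ a i0 + U_(i1) *+ a i1 + U_(i2) *+ a i2)%MM.
  by apply/mnmP => i; rewrite !(mnmDE, mulmnE, mnmE); case: (ord3P i) => -> /=; lia.
rewrite mpolyX3 !rmorphM !rmorphXn /=.
apply: (TM); [apply: (TM)|]; apply: (TX) => d.
- rewrite upull0 addrAC [_ - _ - 'X_i0]addrAC subrr sub0r.
  move/msuppD_le; rewrite mem_cat => /orP[].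
    by rewrite -scaleNr => /msuppZ_le/mem_msuppXP <-; rewrite !mnmE.
  by rewrite -scaleNr => /msuppZ_le/mem_msuppXP <-; rewrite !mnmE.
- by rewrite upull1 addrAC subrr add0r => /msuppZ_le/mem_msuppXP <-; rewrite !mnmE.
by rewrite upull2 subrr msupp0.
Qed.

(** * Frobenius descent *)

Section Frobenius.
Variables (p : nat) (char_k : p \in [pchar k]).

(** The ring endomorphism that raises the parameter X and the three variables to
    the power p, and fixes k. *)
Definition frob : R -> R :=
  mmap (@mpolyC 3 A \o comp_poly 'X^p) (fun i => 'X_i ^+ p).
HB.instance Definition _ := GRing.RMorphism.on frob.

Lemma frobX a : frob 'X_[a] = 'X_[a *+ p].
Proof.
rewrite /frob mmapX /mmap1 mpolyXE_id; apply: eq_bigr => i _.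
by rewrite mulmnE mulnC exprM.
Qed.

Lemma frobZ c f : frob (c *: f) = (c \Po 'X^p) *: frob f.
Proof. by rewrite /frob mmapZ /= mul_mpolyC. Qed.

(** The coefficients of the unipotent action lie in the prime field, so that
    [frob] acts on them as the p-th power map. *)
Lemma frob_upullXU i : frob (upull 'X_i) = upull 'X_i ^+ p.
Proof.
have charA : p \in [pchar A] := rmorph_pchar polyC char_k.
have charR : p \in [pchar R] := rmorph_pchar (@mpolyC 3 A) charA.
have frobXU j : frob 'X_j = 'X_j ^+ p by rewrite frobX -mpolyXn.
have p2 : 2 ^+ p = 2 :> A by rewrite -(pFrobenius_autE charA) rmorph_nat.
have XD (f g : R) : (f + g) ^+ p = f ^+ p + g ^+ p.
  by rewrite -!(pFrobenius_autE charR) rmorphD.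
have XB (f g : R) : (f - g) ^+ p = f ^+ p - g ^+ p.
  by rewrite -!(pFrobenius_autE charR) rmorphB.
case: (ord3P i) => ->.
- rewrite upull0 !rmorphB /= !frobZ !frobXU !XB !exprZn.
  rewrite rmorphM /= !rmorphXn /= rmorph_nat comp_polyX exprMn p2.
  by rewrite -!exprM mulnC.
- by rewrite upull1 rmorphD /= frobZ !frobXU XD exprZn comp_polyX.
by rewrite upull2 frobXU.
Qed.

Lemma frob_upull a : frob (upull 'X_[a]) = upull 'X_[a *+ p].
Proof.
rewrite mpolyXE_id rmorph_prod /= [in RHS]mpolyXE_id !rmorph_prod.
apply: eq_bigr => i _.
by rewrite !rmorphXn /= frob_upullXU mulmnE mulnC exprM.
Qed.

Lemma extpair_frob phi e f :
  extpair A phi (frob f * 'X_[e])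
    = extpair A (fun a => phi (a *+ p + e)%MM) f \Po 'X^p.
Proof.
rewrite [f]mpolyE rmorph_sum mulr_suml !(linear_sum (extpair A _)).
rewrite (raddf_sum (comp_poly 'X^p)).
apply: eq_bigr => a _ /=.
rewrite frobZ frobX -scalerAl -mpolyXD !linearZ /= !extpairX.
rewrite !alg_polyC; apply: etrans (esym (rmorphM (comp_poly 'X^p) _ _)).
by rewrite /= comp_polyC.
Qed.

(** Frobenius descent. Let theta = x^e y^(p-1) z^e. For s in S^m the image of
    s(x^p, y^p, z^p) theta under a unipotent is the p-twisted image of s times the
    image of theta. By [upull_tri] the latter differs from theta by monomials
    x^a y^b z^c of degree 2e + p - 1 with c > a. If one of them contributes, the
    total weight is 0, so c - a is a positive multiple of p. Then
    2a + p <= 2e + p - 1, hence a < e, and the last hypothesis applies. *)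
Lemma upinv_frob n phi m e :
  upinv n phi -> n = (p * m + p.-1 + e.*2)%N ->
  (forall j i b, (i < e)%N -> phi (mnm3 (j * p + i) b (j * p + i)) = 0) ->
  upinv m (fun a => phi (a *+ p + mnm3 e p.-1 e)%MM).
Proof.
move=> upi En vanish; have p_gt0 := prime_gt0 (pcharf_prime char_k).
set theta := mnm3 e p.-1 e.
split=> a.
  case/upi.1; rewrite mdegD mdegMn En (mdeg3 theta) !mnmDE !mulmnE !mnmE /=.
  move=> da aa; split; last by nia.
  have: (mdeg a * p = m * p)%N by lia.
  by move/eqP; rewrite eqn_pmul2r // => /eqP.
have X0 : injective (fun q : A => q \Po 'X^p).
  move=> q r /eqP; rewrite -subr_eq0 -rmorphB /= comp_poly_eq0 ?subr_eq0 => [/eqP //|].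
  by rewrite size_polyXn; lia.
(* Compare both sides after the injective substitution of X^p for X. *)
apply: X0; rewrite -extpair_frob alg_polyC comp_polyC -alg_polyC.
rewrite -upi.2 mpolyXD rmorphM /= -frob_upull.
apply/eqP; rewrite -subr_eq0 -linearB -mulrBr /= -opprB mulrN linearN oppr_eq0.
apply/eqP; move: (upull 'X_[a]) => f.
rewrite [f]mpolyE rmorph_sum mulr_suml linear_sum big1 // => b _.
rewrite /= frobZ frobX -scalerAl linearZ /= extpair_eq0 ?scaler0 // => d.
case/msuppM_le/allpairsP => -[d1 d2] /= [/mem_msuppXP <- Ud2 ->].
have tri := upull_tri Ud2.
have hom : mdeg d2 = mdeg theta.
  apply: (dhomog_mf _ Ud2); apply: rpredB; first exact: sym_pullbackX_homog.
  by rewrite dhomogX.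
apply/eqP/idPn => phid; have [_] := upi.1 _ phid.
rewrite !mnmDE !mulmnE => Ed.
move: hom tri; rewrite !mdeg3 !mnmE /= => hom tri.
have lt_b : (b i2 < b i0)%N by rewrite -(ltn_pmul2r p_gt0); lia.
have lt_p : (d2 i0 + p <= d2 i2)%N.
  by have := leq_mul lt_b (leqnn p); rewrite mulSn; lia.
have lt_e : (d2 i0 < e)%N by lia.
case/eqP: phid; rewrite [(_ + _)%MM]mnm3E !mnmDE !mulmnE -Ed.
exact: vanish.
Qed.
End Frobenius.
End Unipotent.

(** * The recurrence modulo p *)

Lemma double_eq_mod p x y : odd p -> (x <= p)%N -> (y < p)%N ->
  2 * x = 2 * y %[mod p] -> x = y \/ x = p /\ y = 0%N.
Proof.
move=> odd_p le_xp lt_yp /eqP.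
have gauss z : (p %| 2 * z)%N = (p %| z)%N.
  by rewrite Gauss_dvdr // coprimen2.
have [le_yx|lt_xy] := leqP y x.
  rewrite eqn_mod_dvd ?leq_mul2l // -mulnBr gauss => /dvdnP[q].
  by case: q => [|[|q]]; nia.
rewrite eq_sym eqn_mod_dvd ?leq_mul2l ?(ltnW lt_xy) // -mulnBr gauss.
by move/dvdn_leq; lia.
Qed.

Section Recurrence.
Variables (k : fieldType) (m : nat) (psi : nat -> k).
Hypothesis psi_rec : forall c, (c < m)%N ->
  (2 * (m - c)).-1%:R * psi c.+1 = (2 * c.+1)%:R * psi c.

Lemma rec_eq0_up c c' : (c <= c' <= m)%N -> psi c = 0 ->
  (forall i, (c <= i < c')%N -> (2 * (m - i)).-1%:R != 0 :> k) -> psi c' = 0.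
Proof.
case/andP=> le_cc' le_c'm psi0; rewrite -(subnKC le_cc') in le_c'm *.
elim: (c' - c)%N le_c'm => [|d IHd]; first by rewrite addn0.
rewrite addnS => lt_m nz; have /esym/eqP := psi_rec lt_m.
rewrite IHd ?mulr0 1?ltnW // => [|i /andP[? ?]]; last by apply: nz; lia.
by rewrite eq_sym mulf_eq0 (negPf (nz _ _)) ?leq_addr //= => /eqP.
Qed.

Lemma rec_eq0_down c c' : (c <= c' <= m)%N -> psi c' = 0 ->
  (forall i, (c <= i < c')%N -> (2 * i.+1)%:R != 0 :> k) -> psi c = 0.
Proof.
case/andP=> le_cc' le_c'm psi0; have := subnKC le_cc'.
move: (c' - c)%N => d; elim: d c {le_cc'} => [|d IHd] c Ec nz.
  by rewrite -(addn0 c) Ec.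
have lt_cm : (c < m)%N by lia.
have /eqP := psi_rec lt_cm; rewrite (IHd c.+1) ?mulr0; try lia; last first.
  by move=> i hi; apply: nz; lia.
by rewrite eq_sym mulf_eq0 (negPf (nz _ _)) => [/eqP //|]; lia.
Qed.

Variable p : nat.
Hypotheses (char_k : p \in [pchar k]) (p_gt2 : (2 < p)%N).

Let odd_p : odd p.
Proof. by have [|//] := even_prime (pcharf_prime char_k); lia. Qed.

Variables (m' e : nat).
Hypotheses (Em : (2 * m = p * (2 * m') + p.-1 + 2 * e)%N) (lt_ep : (e < p)%N).

(** With c = jp + i the coefficient of psi(c+1) is congruent to 2(e - i - 1)
    modulo p. *)
Lemma rec_coef_eq0 j i : (j * p + i < m)%N -> (i < p)%N ->
  (2 * (m - (j * p + i))).-1%:R = 0 :> k -> i.+1 = e \/ i.+1 = p /\ e = 0%N.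
Proof.
move=> lt_m lt_ip /eqP; rewrite -(dvdn_pcharf char_k) => dv.
apply: double_eq_mod => //.
have [y Ey] := dvdnP dv.
have Ex : ((2 * j + y) * p + 2 * i.+1 = (2 * m' + 1) * p + 2 * e)%N by lia.
by rewrite -(modnMDl (2 * j + y)) Ex modnMDl.
Qed.

Lemma rec_coef_residue j : (j * p + e <= m)%N -> (0 < e)%N ->
  (2 * (m - (j * p + e.-1))).-1%:R = 0 :> k.
Proof.
move=> le_m e_gt0; apply/eqP; rewrite -(dvdn_pcharf char_k).
rewrite -(dvdn_addl _ (dvdn_mull (2 * j) (dvdnn p))).
rewrite (_ : (_ + _)%N = p * (2 * m' + 1))%N ?dvdn_mulr //; nia.
Qed.

(** For j = 0 the recurrence at c = e - 1, where the left factor is 0 in k, gives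
    psi(e-1) = 0, and this propagates downwards. For j > 0 the recurrence at
    c = jp - 1, where the right factor is 0, gives psi(jp) = 0, and this
    propagates upwards. *)
Lemma rec_vanish j i : (i < e)%N -> (j * p + i <= m)%N -> psi (j * p + i) = 0.
Proof.
move=> lt_ie le_m.
have nz2 x : (0 < x < p)%N -> (2 * x)%:R != 0 :> k.
  move=> xp; rewrite -(dvdn_pcharf char_k) Gauss_dvdr ?coprimen2 //.
  by apply/negP => /dvdn_leq; lia.
case: j le_m => [|j] le_m.
  have lt_m : (e.-1 < m)%N by lia.
  rewrite add0n; apply: (@rec_eq0_down i e.-1); first by lia.
    have := psi_rec lt_m; rewrite -[X in (m - X)%N](add0n e.-1) -(mul0n p).
    rewrite rec_coef_residue ?mul0r; try lia.
    move/esym/eqP; rewrite mulf_eq0 (negPf (nz2 _ _)); last by lia.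
    by move/eqP.
  by move=> l ?; apply: nz2; lia.
have lt_m : (j * p + p.-1 < m)%N by lia.
have psi0 : psi (j.+1 * p)%N = 0.
  have /eqP := psi_rec lt_m.
  rewrite (_ : (_ + _).+1 = j.+1 * p)%N; last by lia.
  rewrite natrM (natrM _ j.+1) (pcharf0 char_k) !mulr0 mul0r mulf_eq0.
  case/orP=> [/eqP|/eqP //].
  by case/rec_coef_eq0; lia.
apply: (@rec_eq0_up (j.+1 * p)); [by lia|by []|] => l hl.
rewrite (_ : l = j.+1 * p + (l - j.+1 * p))%N; last by lia.
by apply/eqP => /rec_coef_eq0 []; lia.
Qed.

(** Inside a block no coefficient of psi(c+1) vanishes. *)
Lemma rec_block j : psi (j * p + e) = 0 ->
  forall i, (e <= i < p)%N -> (j * p + i <= m)%N -> psi (j * p + i) = 0.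
Proof.
move=> psi0 i hi le_m.
apply: (@rec_eq0_up (j * p + e)); [by lia|by []|] => l hl.
rewrite (_ : l = j * p + (l - j * p))%N; last by lia.
by apply/eqP => /rec_coef_eq0 []; lia.
Qed.

End Recurrence.

(** * Uniqueness *)

Lemma upinv_unique (k : fieldType) p : p \in [pchar k] -> (2 < p)%N ->
  forall m, exists a0, forall phi, upinv (k := k) (2 * m) phi ->
    phi a0 = 0 -> forall a, phi a = 0.
Proof.
move=> char_k p_gt2.
have odd_p : odd p by have [|//] := even_prime (pcharf_prime char_k); lia.
elim/ltn_ind => m IHm.
pose psi (phi : 'X_{1..3} -> k) c := phi (mnm3 c (2 * (m - c)) c).
have supp phi : upinv (2 * m) phi ->
    (forall c, (c <= m)%N -> psi phi c = 0) -> forall a, phi a = 0.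
  move=> upi psi0 a; apply/eqP/idPn => phia; have [da aa] := upi.1 _ phia.
  case/eqP: phia; rewrite [a]mnm3E -aa; move: da; rewrite mdeg3 -aa => da.
  rewrite (_ : a i1 = 2 * (m - a i0))%N; last by lia.
  by apply: psi0; lia.
have rec phi : upinv (2 * m) phi -> forall c, (c < m)%N ->
    (2 * (m - c)).-1%:R * psi phi c.+1 = (2 * c.+1)%:R * psi phi c.
  move=> upi c lt_cm; rewrite /psi.
  have := upinv_rec (2 * (m - c.+1)) c upi.
  rewrite (_ : (2 * (m - c.+1)).+1 = (2 * (m - c)).-1)%N; last by lia.
  by rewrite (_ : (2 * (m - c)).-1.+1 = 2 * (m - c))%N //; lia.
(* For 2m < p - 1 no coefficient of the recurrence vanishes. *)
have [small|large] := ltnP (2 * m) p.-1.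
  exists (mnm3 0 (2 * m) 0) => phi upi phi0; apply: (supp _ upi) => c le_cm.
  apply: (rec_eq0_up (rec _ upi) (c := 0)); rewrite /psi ?subn0 // => i hi.
  rewrite -(dvdn_pcharf char_k); apply/negP => /dvdn_leq; lia.
(* The only choice of m' and e with 2m = 2pm' + (p - 1) + 2e and e < p. *)
pose h := p./2; pose m' := ((m - h) %/ p)%N; pose e := ((m - h) %% p)%N.
have Ep : p = h.*2.+1 by rewrite /h; lia.
have lt_ep : (e < p)%N by rewrite ltn_mod; lia.
have Em : (2 * m = p * (2 * m') + p.-1 + 2 * e)%N.
  have := divn_eq (m - h) p; rewrite -/m' -/e; nia.
have lt_m'm : (m' < m)%N by nia.
have [a' Ha'] := IHm _ lt_m'm.
exists (a' *+ p + mnm3 e p.-1 e)%MM => phi upi phi0.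
have van j i : (i < e)%N -> (j * p + i <= m)%N -> psi phi (j * p + i)%N = 0.
  exact: (rec_vanish (rec _ upi) char_k p_gt2 Em).
have upi' : upinv (2 * m') (fun a => phi (a *+ p + mnm3 e p.-1 e)%MM).
  apply: (upinv_frob char_k upi); rewrite -?mul2n // => j i b lt_ie.
  apply/eqP/idPn => phia; have [da _] := upi.1 _ phia.
  case/eqP: phia; move: da; rewrite mdeg3 !mnmE /= => da.
  rewrite (_ : b = 2 * (m - (j * p + i)))%N; last by lia.
  by apply: van; lia.
(* Hence psi(jp + e) = 0 for all j <= m', and psi vanishes on each block. *)
have phi'0 := Ha' _ upi' phi0.
apply: (supp _ upi) => c le_cm; rewrite (divn_eq c p).
set j := (c %/ p)%N; set i := (c %% p)%N.
have Ec : c = (j * p + i)%N by exact: divn_eq.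
have lt_ip : (i < p)%N by rewrite ltn_mod; lia.
have [lt_ie|le_ei] := ltnP i e; first by apply: van; lia.
have le_j : (j <= m')%N.
  rewrite -ltnS -(ltn_pmul2r (_ : 0 < p)%N); last by lia.
  by rewrite mulSn; lia.
apply: (rec_block (rec _ upi) char_k p_gt2 Em) => //; try lia.
have := phi'0 (mnm3 j (2 * (m' - j)) j); rewrite /psi => <-; congr phi.
apply/mnmP => l; rewrite mnmDE mulmnE !mnmE; case: (ord3P l) => -> /=; try lia.
by have := mulnBl m' j p; have := leq_mul le_j (leqnn p); lia.
Qed.

(** * The Laplacian *)

(** The chain rule for a linear substitution. *)
Lemma mderiv_sym_pullback d (R : comNzRingType) (M : 'M[R]_d) f i :
  (sym_pullback M f)^`M(i) = \sum_(j < d) M j i *: sym_pullback M f^`M(j).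
Proof.
pose P f := (sym_pullback M f)^`M(i) = \sum_(j < d) M j i *: sym_pullback M f^`M(j).
have P1 : P 1.
  rewrite /P rmorph1 mderivC big1 // => j _.
  by rewrite mderivC linear0 scaler0.
have PM g h : P g -> P h -> P (g * h).
  rewrite /P => Pg Ph; rewrite rmorphM /= mderivM Pg Ph mulr_suml mulr_sumr.
  rewrite -big_split /=.
  apply: eq_bigr => j _; rewrite mderivM rmorphD !rmorphM /= scalerDr.
  by rewrite -scalerAl -scalerAr.
have PX j : P 'X_j.
  rewrite /P sym_pullbackXU linear_sum (bigD1 i) //= [RHS](bigD1 j) //= !big1.
  - by rewrite linearZ /= !mderivXU !eqxx !rmorph_nat.
  - by move=> l nl; rewrite mderivXU eq_sym (negPf nl) rmorph0 scaler0.
  by move=> l nl; rewrite linearZ /= mderivXU (negPf nl) scaler0.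
have PXa a : P 'X_[a] by exact: mpolyX_ind.
rewrite [f]mpolyE (linear_sum (sym_pullback M)) (linear_sum (mderiv i)) /=.
under [RHS]eq_bigr => j _ do
  rewrite (linear_sum (mderiv j)) (linear_sum (sym_pullback M)) scaler_sumr.
rewrite exchange_big; apply: eq_bigr => a _ /=.
rewrite !linearZ /= [X in _ *: X](PXa a) scaler_sumr.
by apply: eq_bigr => j _; rewrite !linearZ /= !scalerA mulrC.
Qed.

Lemma mderiv2_sym_pullback d (R : comNzRingType) (M : 'M[R]_d) f i l :
  (sym_pullback M f)^`M(i)^`M(l) = \sum_(j < d) \sum_(j' < d)
    (M j i * M j' l) *: sym_pullback M f^`M(j)^`M(j').
Proof.
rewrite mderiv_sym_pullback (linear_sum (mderiv l)); apply: eq_bigr => j _.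
rewrite linearZ /= mderiv_sym_pullback scaler_sumr.
by apply: eq_bigr => j' _; rewrite scalerA.
Qed.

Section Laplacian.
Variable R : comNzRingType.
Implicit Type f : {mpoly R[3]}.

(** The differential operator dual to the invariant quadratic form y^2 + x z. *)
Definition lap f : {mpoly R[3]} := 4 *: f^`M(i0)^`M(i2) + f^`M(i1)^`M(i1).

Lemma lap_linear : linear lap.
Proof.
by move=> c f g; rewrite /lap !linearP /= -!mul_mpolyC; ring.
Qed.

HB.instance Definition _ := GRing.isLinear.Build R {mpoly R[3]} {mpoly R[3]}
  *:%R lap lap_linear.

(** The quadratic form y^2 + x z is minus the determinant of X, and g X adj(g) has
    determinant det(g)^2 det(X). The chain rule turns this into an identity
    between the entries of [sl2_Ad g]. *)
Lemma lap_sym_pullback (g : 'M[R]_2) f :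
  lap (sym_pullback (sl2_Ad g) f) = \det g ^+ 2 *: sym_pullback (sl2_Ad g) (lap f).
Proof.
(* The second derivatives are replaced by variables before expanding. *)
have [P [dP PE Psym]] : exists P : 'I_3 -> 'I_3 -> {mpoly R[3]},
    [/\ forall i l, (sym_pullback (sl2_Ad g) f)^`M(i)^`M(l)
          = \sum_(j < 3) \sum_(j' < 3) (sl2_Ad g j i * sl2_Ad g j' l) *: P j j',
        forall i l, sym_pullback (sl2_Ad g) f^`M(i)^`M(l) = P i l
      & forall i l, P i l = P l i].
  exists (fun i l => sym_pullback (sl2_Ad g) f^`M(i)^`M(l)).
  by split=> // i l; [rewrite mderiv2_sym_pullback | rewrite mderiv_comm].
rewrite /lap (linearP (sym_pullback (sl2_Ad g))) /= !dP !PE !sum3.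
rewrite !(Psym i1 i0) !(Psym i2 i0) !(Psym i2 i1).
rewrite !sl2_AdP /= det2 -!mul_mpolyC.
rewrite !(rmorphN, rmorph_nat, rmorphM, rmorphB, rmorphXn, rmorphD) /=.
ring.
Qed.

Lemma mcoeff0_sym_pullback d (M : 'M[R]_d) (f : {mpoly R[d]}) :
  (sym_pullback M f)@_0 = f@_0.
Proof.
rewrite [in RHS](mpolyE f) [X in sym_pullback _ X](mpolyE f).
rewrite (linear_sum (sym_pullback M)) !(linear_sum (mcoeff _)).
apply: eq_bigr => a _; rewrite !linearZ /=; congr (_ * _).
have [->|nz] := eqVneq a 0%MM; first by rewrite mpolyX0 rmorph1.
rewrite mcoeffX (negPf nz) (dhomog_nemf_coeff (sym_pullbackX_homog M a)) //=.
by rewrite mdeg0 eq_sym mdeg_eq0.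
Qed.

Definition lapn m f : R^o := (iter m lap f)@_0.

Lemma lapn_linear m : linear (lapn m).
Proof.
move=> c f g; rewrite /lapn.
have -> : iter m lap (c *: f + g) = c *: iter m lap f + iter m lap g.
  by elim: m => //= m ->; rewrite linearP.
by rewrite linearP.
Qed.

HB.instance Definition _ m := GRing.isLinear.Build R {mpoly R[3]} R^o
  *:%R (lapn m) (lapn_linear m).

Lemma lapn_sym_pullback m (g : 'M[R]_2) f :
  lapn m (sym_pullback (sl2_Ad g) f) = \det g ^+ (2 * m) * lapn m f.
Proof.
rewrite /lapn (_ : iter m _ _ =
   \det g ^+ (2 * m) *: sym_pullback (sl2_Ad g) (iter m lap f)).
  by rewrite linearZ /= mcoeff0_sym_pullback.
elim: m => [|m IHm]; first by rewrite scale1r.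
rewrite !iterS IHm linearZ /= lap_sym_pullback scalerA -exprD.
by congr (_ ^+ _ *: _); lia.
Qed.

End Laplacian.

(** * Change of rings *)

Lemma mderiv_map d (R S : comNzRingType) (h : {rmorphism R -> S})
    (f : {mpoly R[d]}) i :
  (map_mpoly h f)^`M(i) = map_mpoly h f^`M(i).
Proof.
apply/mpolyP => a.
by rewrite mcoeff_map_mpoly /= !mcoeff_mderiv mcoeff_map_mpoly rmorphMn.
Qed.

Lemma lapn_map (R S : comNzRingType) (h : {rmorphism R -> S}) m
    (f : {mpoly R[3]}) :
  lapn m (map_mpoly h f) = h (lapn m f).
Proof.
rewrite /lapn -mcoeff_map_mpoly; congr mcoeff; elim: m => //= m ->.
rewrite /lap !mderiv_map rmorphD /=; congr (_ + _).
by rewrite map_mpolyZ rmorph_nat.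
Qed.

Lemma sl2_Ad_map (R S : comNzRingType) (h : {rmorphism R -> S}) (g : 'M[R]_2) :
  sl2_Ad (map_mx h g) = map_mx h (sl2_Ad g).
Proof.
apply/matrixP => i j; rewrite [RHS]mxE !sl2_AdP !mxE.
by case: (ord3P i) => ->; case: (ord3P j) => -> /=;
  rewrite !(rmorphN, rmorph_nat, rmorphM, rmorphXn, rmorphD).
Qed.

Lemma sym_pullback_map d (R S : comNzRingType) (h : {rmorphism R -> S})
    (M : 'M[R]_d) a :
  map_mpoly h (sym_pullback M 'X_[a]) = sym_pullback (map_mx h M) 'X_[a].
Proof.
rewrite mpolyXE_id [in RHS]mpolyXE_id.
rewrite !(rmorph_prod (sym_pullback _)) (rmorph_prod (map_mpoly h)).
apply: eq_bigr => i _.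
rewrite !(rmorphXn (sym_pullback _)) (rmorphXn (map_mpoly h)) /=.
rewrite !sym_pullbackXU rmorph_sum /=.
congr (_ ^+ _); apply: eq_bigr => j _.
by rewrite mxE map_mpolyZ map_mpolyX.
Qed.

Lemma dp_act_map d (R S : comNzRingType) (h : {rmorphism R -> S})
    (M : 'M[R]_d) (u : divpow d R) :
  map_mpoly h (dp_act M u) = dp_act (map_mx h M) (map_mpoly h u).
Proof.
apply/mpolyP => a; rewrite mcoeff_map_mpoly /= !mcoeff_dp_act -sym_pullback_map.
move: (sym_pullback M _) => f.
have -> : map_mpoly h f = \sum_(b <- msupp f) h f@_b *: 'X_[b].
  rewrite [in LHS](mpolyE f) rmorph_sum; apply: eq_bigr => b _.
  by rewrite /= map_mpolyZ map_mpolyX.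
rewrite [X in dp_pair u X](mpolyE f) !(linear_sum (dp_pair _)) rmorph_sum.
apply: eq_bigr => b _; rewrite !linearZ /= !dp_pairX.
by rewrite rmorphM mcoeff_map_mpoly.
Qed.

(** * An invariant over the integers and its reduction *)

(** The element (h^2 + 4 e f)^m of the divided power algebra over the integers: D
    acts on S by differential operators with constant coefficients, and
    h^2 + 4 e f acts as [lap]. *)
Definition casimir (m : nat) : divpow 3 int :=
  \sum_(a : 'X_{1..3 < (2 * m).+1} | mdeg a == (2 * m)%N)
    lapn m 'X_[a] *: dp_basis int a.

Lemma casimirE m a : mcoeff a (casimir m) =
  if mdeg a == (2 * m)%N then lapn m 'X_[a] else 0.
Proof.
rewrite [X in mcoeff _ X](_ : _ =
  \sum_(b : 'X_{1..3 < (2 * m).+1} | mdeg b == (2 * m)%N)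
    lapn m 'X_[b] *: 'X_[b] :> {mpoly int[3]}) //.
rewrite linear_sum /=; case: eqP => da.
  have lt_a : (mdeg a < (2 * m).+1)%N by rewrite da.
  rewrite (bigD1 (BMultinom lt_a)) /=; last by rewrite da.
  rewrite big1 => [|b /andP[_ nb]]; rewrite linearZ /= mcoeffX.
    by rewrite eqxx mulr1 addr0.
  by rewrite -[a]/(bmnm (BMultinom lt_a)) (inj_eq val_inj) (negPf nb) mulr0.
rewrite big1 // => b /eqP db; rewrite linearZ /= mcoeffX.
by case: eqP => [ba|_]; [case: da; rewrite -ba | rewrite mulr0].
Qed.

(** Its coefficient on h^(2m) is the value (2m)! of d_y^(2m) on y^(2m). *)
Lemma casimir_neq0 m : casimir m != 0.
Proof.
apply/eqP => /(congr1 (mcoeff (mnm3 0 (2 * m) 0))).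
rewrite casimirE mdeg3 !mnmE /= addn0 eqxx mcoeff0 /lapn => /eqP.
have lapX l (c : int) : lap (c *: 'X_[mnm3 0 l.+2 0]) =
    (c * (l.+2 * l.+1)%:R) *: 'X_[mnm3 0 l 0].
  rewrite /lap !linearZ /= !mderivX !linearZ /= !mderivX !mnmE /= scale0r.
  rewrite !scaler0 add0r !scalerA subn1 natrM mulrA (mulrC c).
  congr (_ *: 'X_[_]); apply/mnmP => i.
  by rewrite !(mnmBE, mnmE); case: (ord3P i) => -> /=; lia.
have iter_lap l : forall c : int, c != 0 -> exists2 c' : int, c' != 0 &
    iter l (@lap int) (c *: 'X_[mnm3 0 (2 * l) 0]) = c' *: 'X_[mnm3 0 0 0].
  elim: l => [|l IHl] c c0; first by exists c.
  rewrite iterSr (_ : 2 * l.+1 = (2 * l).+2)%N; last by lia.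
  by rewrite lapX; apply: IHl; rewrite mulf_neq0 // Num.Theory.pnatr_eq0.
have [c c0] := iter_lap m 1 isT; rewrite scale1r => ->.
rewrite mcoeffZ mcoeffX (_ : mnm3 0 0 0 = 0%MM) ?eqxx ?mulr1 ?(negPf c0) //.
by apply/mnmP => i; rewrite mnmE mnm0E; case: (ord3P i) => ->.
Qed.

Lemma dp_act_casimir (R : comNzRingType) (h : {rmorphism int -> R}) m
    (g : 'M[R]_2) :
  dp_act (sl2_Ad g) (map_mpoly h (casimir m))
    = \det g ^+ (2 * m) *: (map_mpoly h (casimir m)).
Proof.
set w := map_mpoly h (casimir m).
have wE a : mcoeff a w =
    if mdeg a == (2 * m)%N then lapn m ('X_[a] : {mpoly R[3]}) else 0.
  rewrite mcoeff_map_mpoly /= casimirE (fun_if h) rmorph0 -lapn_map.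
  by rewrite map_mpolyX.
have hw : (w : {mpoly R[3]}) \is (2 * m).-homog.
  apply/dhomogP => a; rewrite mcoeff_msupp wE; case: (mdeg a =P _) => //.
  by rewrite eqxx.
apply/mpolyP => a; rewrite mcoeffZ.
have [da|da] := eqVneq (mdeg a) (2 * m)%N; last first.
  rewrite (dhomog_nemf_coeff (dp_act_homog _ hw)) //.
  by rewrite (dhomog_nemf_coeff hw) ?mulr0.
rewrite mcoeff_dp_act wE da eqxx -lapn_sym_pullback.
have := sym_pullbackX_homog (sl2_Ad g) a; rewrite da.
move: (sym_pullback _ _) => f /dhomog_mf hf.
rewrite [in RHS](mpolyE f) [X in dp_pair _ X](mpolyE f).
rewrite (linear_sum (dp_pair _)) (linear_sum (lapn m)) big_seq [RHS]big_seq.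
apply: eq_bigr => b fb; rewrite !linearZ /= dp_pairX wE.
by rewrite [mdeg b](hf _ fb) eqxx.
Qed.

(** Divide by p as long as all coefficients allow it; a nonzero coefficient
    decreases in absolute value. *)
Lemma divpow_primitive d (w : divpow d int) (p : nat) : (1 < p)%N -> w != 0 ->
  exists N : int, exists u : divpow d int,
    [/\ N != 0, w = N *: u & exists a, ~~ (p %| mcoeff a u)%Z].
Proof.
move=> p_gt1 w0; have [b wb] : exists b, mcoeff b w != 0.
  by exists (mlead (w : {mpoly int[d]})); rewrite mleadc_eq0.
have [n le_n] := ubnP `|mcoeff b w|%N.
elim: n w {w0} wb le_n => // n IHn w wb le_n.
have [/hasP[a _ wa]|/hasPn alldiv] :=
    boolP (has (fun a => ~~ (p %| mcoeff a w)%Z) (msupp w)).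
  by exists 1, w; split; [|rewrite scale1r|exists a].
pose v : divpow d int := \sum_(a <- msupp w) (mcoeff a w %/ p)%Z *: dp_basis int a.
have wE : w = p%:Z *: v.
  rewrite {1}[w]dp_expand /dp_ext /v scaler_sumr.
  rewrite !big_seq; apply: eq_bigr => a /alldiv/negPn pa.
  by rewrite scalerA mulrC divzK.
have wbE : mcoeff b w = p%:Z * mcoeff b v by rewrite {1}wE mcoeffZ.
have vb : mcoeff b v != 0 by apply: contraNneq wb => vb; rewrite wbE vb mulr0.
have lt_vb : (`|mcoeff b v| < n)%N.
  apply: leq_trans (_ : `|mcoeff b w| <= n)%N; last by [].
  by rewrite wbE abszM ltn_Pmull // absz_gt0.
have [N [u [N0 vE ua]]] := IHn v vb lt_vb.
exists (p%:Z * N), u; split=> //; first by rewrite mulf_neq0 //; lia.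
by rewrite wE {1}vE scalerA.
Qed.

Definition generic_mx2 : 'M[{mpoly int[4]}]_2 :=
  mx2 'X_(@Ordinal 4 0 isT) 'X_(@Ordinal 4 1 isT)
      'X_(@Ordinal 4 2 isT) 'X_(@Ordinal 4 3 isT).

Lemma generic_mx2P (A : comNzRingType) (g : 'M[A]_2) :
  exists h : {rmorphism {mpoly int[4]} -> A}, g = map_mx h generic_mx2.
Proof.
pose v (i : 'I_4) := [:: g 0 0; g 0 1; g 1 0; g 1 1]`_i.
exists (mmap (intmul 1) v); apply/matrixP => i j; rewrite !mxE.
have ord2 (l : 'I_2) : l = 0 \/ l = 1.
  by case: l => [[|[|//]] ?]; [left | right]; apply: val_inj.
by case: (ord2 i) => ->; case: (ord2 j) => -> /=; rewrite mmapX mmap1U.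
Qed.

Lemma dp_act_divided_casimir_domain (R : idomainType) (h : {rmorphism int -> R}) m
    (N : int) (u : divpow 3 int) (g : 'M[R]_2) :
  h N != 0 -> casimir m = N *: u ->
  dp_act (sl2_Ad g) (map_mpoly h u) = \det g ^+ (2 * m) *: map_mpoly h u.
Proof.
move=> hN0 wE; have := dp_act_casimir h m g.
have -> : map_mpoly h (casimir m) = h N *: map_mpoly h u.
  by rewrite wE; exact: map_mpolyZ.
rewrite linearZ /= => E; apply/mpolyP => b; apply: (mulfI hN0).
by rewrite -!mcoeffZ [X in mcoeff _ X = _]E !scalerA mulrC.
Qed.

(** Every matrix is a specialization of the generic one, whose entries live in a
    domain where N is not zero and can be cancelled. *)
Lemma dp_act_divided_casimir m (N : int) (u : divpow 3 int) :
  N != 0 -> casimir m = N *: u ->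
  forall (A : comNzRingType) (g : 'M[A]_2),
    dp_act (sl2_Ad g) (map_mpoly intr u) = \det g ^+ (2 * m) *: map_mpoly intr u.
Proof.
move=> N0 wE A g; have [h gE] := generic_mx2P g.
have hE : map_mpoly intr u = map_mpoly h (map_mpoly (@mpolyC 4 int) u).
  apply/mpolyP => a; rewrite !mcoeff_map_mpoly /=.
  by rewrite -[X in mpolyC _ X]intz !rmorph_int.
have NC0 : N%:MP_[4] != 0 by rewrite mpolyC_eq0.
rewrite hE gE sl2_Ad_map -dp_act_map (dp_act_divided_casimir_domain _ NC0 wE).
by rewrite [LHS]map_mpolyZ rmorphXn det_map_mx.
Qed.

Lemma exists_dpinv (k : fieldType) p m : p \in [pchar k] ->
  exists2 u : divpow 3 k, is_dpinv (2 * m) u & u != 0.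
Proof.
move=> char_k; have p_gt1 := prime_gt1 (pcharf_prime char_k).
have [N [u [N0 wE [a ua]]]] := divpow_primitive p_gt1 (casimir_neq0 m).
exists (map_mpoly intr u).
  apply/andP; split.
    apply/dhomogP => b; rewrite mcoeff_msupp mcoeff_map_mpoly /= => ub.
    have : mcoeff b (casimir m) != 0.
      rewrite wE mcoeffZ mulf_neq0 //; apply: contraNneq ub => ->.
      by rewrite mulr0z.
    by rewrite casimirE; case: (mdeg b =P _) => //; rewrite eqxx.
  apply/asboolP => A g det1.
  have -> : dp_base_change A (map_mpoly intr u) = map_mpoly intr u.
    by apply/mpolyP => b; rewrite !mcoeff_map_mpoly; exact: (rmorph_int (in_alg A)).
  by rewrite (dp_act_divided_casimir N0 wE) det1 expr1n scale1r.
apply/eqP => /(congr1 (mcoeff a)); rewrite mcoeff_map_mpoly mcoeff0 /= => /eqP.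
by rewrite -(dvdz_pcharf char_k) (negPf ua).
Qed.

(** * Dimension of the invariants *)

Section Coefficient.
Variables (k : fieldType) (n : nat) (a : 'X_{1..3}).

Definition dpinv_coef (u : dpinv k n) : k^o := mcoeff a (dpinv_val u).

Lemma dpinv_coef_linear : linear dpinv_coef.
Proof. by move=> c u v; rewrite /dpinv_coef linearP. Qed.

HB.instance Definition _ := GRing.isLinear.Build k (dpinv k n) k^o *:%R
  dpinv_coef dpinv_coef_linear.
End Coefficient.

Theorem corollary6p6 (k : fieldType) (p : nat) (char_k : p \in [pchar k])
    (p_gt2 : (2 < p)%N) (n : nat) :
  (~~ odd n -> exists f : {linear dpinv k n -> k^o}, bijective f) /\
  (odd n -> forall u : dpinv k n, u = 0).
Proof.
split=> [even_n|odd_n u]; last first.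
  apply: val_inj; apply: (dpinv_odd _ odd_n (dpinvP u)).
  by rewrite -(dvdn_pcharf char_k); apply/negP => /dvdn_leq; lia.
have -> : n = (2 * n./2)%N by lia.
move: n./2 => m {n even_n}.
have [a0 Ha0] := upinv_unique char_k p_gt2 m.
pose f : {linear dpinv k (2 * m) -> k^o} := @dpinv_coef k (2 * m) a0.
have f0 u : f u = 0 -> u = 0.
  move=> fu; apply: val_inj; apply/mpolyP => a; rewrite mcoeff0.
  exact: Ha0 (dpinv_upinv (dpinvP u)) fu a.
have [w inv_w w0] := exists_dpinv m char_k.
(* The coefficient at a0 is injective on invariants, hence nonzero on w. *)
pose W : dpinv k (2 * m) := DPInv inv_w.
have fW : f W != 0.
  by apply: contra_neq w0 => /f0 /(congr1 (@dpinv_val _ _)).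
exists f; exists (fun c : k => ((c / f W : k) *: W : dpinv k (2 * m))) => [u|c].
  apply/eqP; rewrite -subr_eq0; apply/eqP/f0.
  by rewrite linearB linearZ /= -[_ *: (_ : k^o)]/(_ * _) mulfVK // subrr.
by rewrite linearZ /= -[_ *: (_ : k^o)]/(_ * _) mulfVK.
Qed.
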